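(* Let $G=(V,E,c)$ be a finite connected weighted graph with positive edge conductances and effective-resistance matrix $R$, and for nonempty $S\subseteq V$ put $\rho_G(S)=\det R[S]/\operatorname{cof}R[S]$. If $\varnothing\neq A\subseteq B\subseteq V$, then $$\rho_G(A)\le\rho_G(B).$$
   Context: $G=(V,E,c)$ is a finite connected undirected graph with edge conductances $c_e>0$; parallel edges are allowed, loops are omitted. With $N\in\mathbb{R}^{V\times E}$ the incidence matrix for an arbitrary orientation and $C=\operatorname{diag}(c_e)$, the weighted Laplacian is $L=NCN^{\mathsf T}$, and $L^+$ is its Moore--Penrose pseudoinverse. The effective resistance between $i,j\in V$ is $R_{ij}=(e_i-e_j)^{\mathsf T}L^+(e_i-e_j)$, and $R=(R_{ij})_{i,j\in V}$. For $S\subseteq V$, $R[S]$ is the principal submatrix of $R$ indexed by $S$. For a square matrix $M$, $\operatorname{cof}M=\sum_{i,j}(-1)^{i+j}\det M(i|j)$ is the sum of all cofactors, where $M(i|j)$ is $M$ with row $i$ and column $j$ deleted; for a $1\times1$ matrix it equals $1$. It is a fact that $\operatorname{cof}R[S]\ne0$ for every nonempty $S$, so $\rho_G(S)$ is well defined; $\rho_G(S)=0$ when $|S|=1$. *)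

(* Defs.v *)
From HB Require Import structures.
From mathcomp Require Import all_boot all_order all_algebra.

Set Implicit Arguments.
Unset Strict Implicit.
Unset Printing Implicit Defensive.

Import Order.TTheory GRing.Theory Num.Theory.
Local Open Scope ring_scope.

(* Edges form a type of their own, so parallel edges are allowed.  The choice
   of a tail and a head for each edge is the arbitrary orientation used to
   write the incidence matrix; adjacency below ignores it. *)
Record wgraph (R : realFieldType) (V E : finType) := WGraph {
  tail : E -> V;
  head : E -> V;
  conductance : E -> R;
  loopless : forall e, tail e != head e;
  conductance_gt0 : forall e, 0 < conductance e
}.

Definition adjacent (R : realFieldType) (V E : finType) (G : wgraph R V E)
    : rel V :=
  [rel x y | [exists e, [|| (tail G e == x) && (head G e == y)
                          | (tail G e == y) && (head G e == x)]]].

Definition connected (R : realFieldType) (V E : finType) (G : wgraph R V E)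
    : Prop :=
  forall x y : V, connect (adjacent G) x y.

(* Matrices indexed by V and E are indexed by 'I_#|V| and 'I_#|E| through
   enum_val / enum_rank. *)
Definition incidence (R : realFieldType) (V E : finType) (G : wgraph R V E)
    : 'M[R]_(#|V|, #|E|) :=
  \matrix_(i, k) ((enum_val i == head G (enum_val k))%:R
                  - (enum_val i == tail G (enum_val k))%:R).

Definition conductance_mx (R : realFieldType) (V E : finType)
    (G : wgraph R V E) : 'M[R]_#|E| :=
  diag_mx (\row_k conductance G (enum_val k)).

Definition laplacian (R : realFieldType) (V E : finType) (G : wgraph R V E)
    : 'M[R]_#|V| :=
  incidence G *m conductance_mx G *m (incidence G)^T.

(* The four Penrose equations. *)
Definition is_MPinverse (R : realFieldType) (m n : nat)
    (A : 'M[R]_(m, n)) (X : 'M[R]_(n, m)) : Prop :=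
  [/\ A *m X *m A = A,
      X *m A *m X = X,
      (A *m X)^T = A *m X
    & (X *m A)^T = X *m A].

(* mathcomp's pinvmx is only a partial inverse.  The Moore-Penrose inverse is
   computed here from the full-rank factorization A = F G with F := col_base A
   and G := row_base A, as G^T (G G^T)^-1 (F^T F)^-1 F^T; MPinverseP and
   is_MPinverse_uniq show that it is the unique solution of the Penrose
   equations. *)
Definition MPinverse (R : realFieldType) (m n : nat) (A : 'M[R]_(m, n))
    : 'M[R]_(n, m) :=
  (row_base A)^T *m invmx (row_base A *m (row_base A)^T)
  *m invmx ((col_base A)^T *m col_base A) *m (col_base A)^T.

Lemma mulmx_trmx_eq0 (R : realFieldType) (n : nat) (v : 'rV[R]_n) :
  v *m v^T = 0 -> v = 0.
Proof.
move=> /matrixP/(_ 0 0); rewrite !mxE => /eqP.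
rewrite psumr_eq0 => [/allP h|i _]; last by rewrite mxE -expr2 sqr_ge0.
apply/rowP=> i; rewrite mxE; apply/eqP.
by have := h i (mem_index_enum _); rewrite /= mxE mulf_eq0 orbb.
Qed.

Lemma gram_unitmx (R : realFieldType) (r n : nat) (A : 'M[R]_(r, n)) :
  row_free A -> A *m A^T \in unitmx.
Proof.
move=> fA; rewrite -row_free_unit -kermx_eq0; apply/eqP/row_matrixP=> i.
rewrite row0; set v := row i _.
have hv : v *m (A *m A^T) = 0 by rewrite /v -row_mul mulmx_ker row0.
have : v *m A = 0.
  by apply: mulmx_trmx_eq0; rewrite trmx_mul -mulmxA (mulmxA A) mulmxA hv mul0mx.
by move/eqP; rewrite mulmx_free_eq0 // => /eqP.
Qed.

Lemma is_MPinverse_factor (R : realFieldType) (m r n : nat)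
    (F : 'M[R]_(m, r)) (G : 'M[R]_(r, n)) :
  F^T *m F \in unitmx -> G *m G^T \in unitmx ->
  is_MPinverse (F *m G)
    (G^T *m invmx (G *m G^T) *m invmx (F^T *m F) *m F^T).
Proof.
move=> uF uG; set P := invmx (G *m G^T); set Q := invmx (F^T *m F).
have tP : P^T = P by rewrite /P trmx_inv trmx_mul trmxK.
have tQ : Q^T = Q by rewrite /Q trmx_inv trmx_mul trmxK.
have hAX : F *m G *m (G^T *m P *m Q *m F^T) = F *m Q *m F^T.
  by rewrite !mulmxA -(mulmxA F G) -(mulmxA F _ P) mulmxV // mulmx1.
have hXA : G^T *m P *m Q *m F^T *m (F *m G) = G^T *m P *m G.
  by rewrite !mulmxA -(mulmxA _ F^T F) -(mulmxA _ Q) mulVmx // mulmx1.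
split.
- by rewrite hAX !mulmxA -(mulmxA _ F^T F) -(mulmxA F Q) mulVmx // mulmx1.
- by rewrite hXA !mulmxA -(mulmxA _ G G^T) -(mulmxA _ (G *m _) P) mulmxV // mulmx1.
- by rewrite hAX !trmx_mul trmxK tQ mulmxA.
- by rewrite hXA !trmx_mul trmxK tP mulmxA.
Qed.

Lemma MPinverseP (R : realFieldType) (m n : nat) (A : 'M[R]_(m, n)) :
  is_MPinverse A (MPinverse A).
Proof.
have uG := gram_unitmx (row_base_free A).
have uF : (col_base A)^T *m col_base A \in unitmx.
  rewrite -{2}[col_base A]trmxK; apply: gram_unitmx.
  by rewrite /row_free mxrank_tr; exact: col_base_full.
by have := is_MPinverse_factor uF uG; rewrite mulmx_base.
Qed.

Lemma is_MPinverse_uniq (R : realFieldType) (m n : nat) (A : 'M[R]_(m, n))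
    (X Y : 'M[R]_(n, m)) :
  is_MPinverse A X -> is_MPinverse A Y -> X = Y.
Proof.
move=> [x1 x2 x3 x4] [y1 y2 y3 y4].
have hA : A *m X = A *m Y.
  by rewrite -x3 -{1}y1 -(mulmxA (A *m Y)) trmx_mul x3 y3 mulmxA x1.
have hB : X *m A = Y *m A.
  by rewrite -x4 -{1}y1 -mulmxA mulmxA trmx_mul y4 x4 -mulmxA (mulmxA A) x1.
by rewrite -x2 hB -mulmxA hA mulmxA y2.
Qed.

Definition unit_vec (R : realFieldType) (V : finType) (i : V)
    : 'cV[R]_#|V| :=
  delta_mx (enum_rank i) 0.

Definition eff_res (R : realFieldType) (V E : finType) (G : wgraph R V E)
    (i j : V) : R :=
  ((unit_vec R i - unit_vec R j)^T *m MPinverse (laplacian G)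
   *m (unit_vec R i - unit_vec R j)) 0 0.

Definition res_mx (R : realFieldType) (V E : finType) (G : wgraph R V E)
    : 'M[R]_#|V| :=
  \matrix_(i, j) eff_res G (enum_val i) (enum_val j).

Definition principal_submx (R : realFieldType) (V : finType)
    (M : 'M[R]_#|V|) (S : {set V}) : 'M[R]_#|S| :=
  mxsub (fun k : 'I_#|S| => enum_rank (enum_val k))
        (fun k : 'I_#|S| => enum_rank (enum_val k)) M.

(* For n = 1 this is 1, the determinant of the empty matrix. *)
Definition cof (R : realFieldType) (n : nat) (M : 'M[R]_n) : R :=
  \sum_i \sum_j cofactor M i j.

Definition rho (R : realFieldType) (V E : finType) (G : wgraph R V E)
    (S : {set V}) : R :=
  \det (principal_submx (res_mx G) S) / cof (principal_submx (res_mx G) S).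

(* Main.v *)
Require Import Defs.
From mathcomp Require Import all_boot all_order all_algebra.
From mathcomp Require Import ring.

Set Implicit Arguments.
Unset Strict Implicit.
Unset Printing Implicit Defensive.

Import Order.TTheory GRing.Theory Num.Theory.
Local Open Scope ring_scope.

(** On vectors of zero sum the quadratic form of [R = res_mx G] is [-2] times
    that of [L^+], which is positive definite there when [G] is connected
    ([MPlaplacian_posdef]).  Hence [q |-> q^T R q] is strictly concave on the
    affine space of charges of total mass 1 supported in [S] ([res_mx_cnd]).

    Its critical point over [S] is the equilibrium charge: the [q] of mass 1 on
    [S] whose potential [R q] is constant on [S].  That constant is at once the
    value [q^T R q] and [det R[S] / cof R[S]], because [cof R[S]] is the sum of
    the entries of the adjugate ([equilibrium_charge], [rho_equilibrium]).  So
    [rho G S] is the maximum of [q^T R q] over the charges of mass 1 supported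
    in [S], and a larger [S] offers more charges.

    The maximum principle is used in one stroke: if [p] and [q] are the
    equilibrium charges of [A] and [B], then the potential of [q] is constant on
    the support of [p], so that
    [(p - q)^T R (p - q) = rho A - 2 rho B + rho B = rho A - rho B],
    which is not positive since [p - q] has zero sum. *)

(** * Quadratic forms on vectors of zero sum *)

Definition cond_neg_def (R : realFieldType) (n : nat) (M : 'M[R]_n) : Prop :=
  forall x : 'cV[R]_n, const_mx 1 *m x = 0 :> 'M_1 -> x != 0 ->
    (x^T *m M *m x) 0 0 < 0.

Lemma mass_sum (R : realFieldType) (n : nat) (x : 'cV[R]_n) :
  (const_mx 1 *m x : 'M_1) 0 0 = \sum_i x i 0.
Proof. by rewrite mxE; apply: eq_bigr => i _; rewrite mxE mul1r. Qed.

Lemma cond_neg_def_le0 (R : realFieldType) (n : nat) (M : 'M[R]_n)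
    (x : 'cV[R]_n) :
  cond_neg_def M -> const_mx 1 *m x = 0 :> 'M_1 -> (x^T *m M *m x) 0 0 <= 0.
Proof.
move=> cndM x1; have [->|/(cndM _ x1)/ltW//] := eqVneq x 0.
by rewrite mulmx0 mxE.
Qed.

Lemma cof_adj (R : realFieldType) (n : nat) (M : 'M[R]_n) :
  const_mx 1 *m \adj M *m const_mx 1 = (cof M)%:M :> 'M_1.
Proof.
apply/matrixP => i j; rewrite !ord1 mxE mxE eqxx mulr1n; apply: eq_bigr => k _.
rewrite !mxE mulr1; apply: eq_bigr => l _.
by rewrite !mxE mul1r.
Qed.

(** A vector killed by [M], or solving [M x = 1], cannot have zero sum, since
    [x^T M x] would vanish; it can therefore be rescaled to mass 1.  In the
    invertible case the constant is the inverse of the sum of the entries of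
    [M^-1 = \adj M / \det M], that is [\det M / cof M]; in the singular case it
    is [0], and [\det M = 0]. *)
Lemma equilibrium_charge (R : realFieldType) (n : nat) (M : 'M[R]_n.+1) :
  cond_neg_def M ->
  exists2 x : 'cV[R]_n.+1, const_mx 1 *m x = 1%:M :> 'M_1
    & M *m x = const_mx (\det M / cof M).
Proof.
move=> cndM.
have mass_neq0 (x : 'cV[R]_n.+1) a :
    x != 0 -> M *m x = const_mx a -> (const_mx 1 *m x : 'M_1) 0 0 != 0.
  move=> x_neq0 Mx; apply/eqP => x1; suff: (x^T *m M *m x) 0 0 = 0.
    move=> e; suff: const_mx 1 *m x = 0 :> 'M_1.
      by move=> /cndM/(_ x_neq0); rewrite e ltxx.
    by apply/matrixP => i j; rewrite !ord1 x1 mxE.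
  rewrite -mulmxA Mx -[RHS](mulr0 a) -x1 mass_sum mulr_sumr [LHS]mxE.
  by apply: eq_bigr => i _; rewrite !mxE mulrC.
have [uM|sM] := boolP (M \in unitmx); last first.
  have dM : \det M = 0 by move: sM; rewrite unitmxE unitfE negbK => /eqP.
  have /det0P[v v_neq0 vM] : \det M^T == 0 by rewrite det_tr dM.
  have Mv : M *m v^T = const_mx 0.
    by rewrite -[M]trmxK -trmx_mul vM trmx0; apply/matrixP=> i j; rewrite !mxE.
  have := mass_neq0 v^T 0; rewrite -trmx0 (inj_eq trmx_inj) => /(_ v_neq0 Mv) m0.
  exists (((const_mx 1 *m v^T : 'M_1) 0 0)^-1 *: v^T).
    rewrite -scalemxAr; apply/matrixP => i j.
    by rewrite !ord1 [LHS]mxE mulVf // mxE.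
  by rewrite -scalemxAr Mv dM mul0r; apply/matrixP=> i j; rewrite !mxE mulr0.
pose x : 'cV[R]_n.+1 := invmx M *m const_mx 1.
have Mx : M *m x = const_mx 1 by rewrite mulmxA mulmxV // mul1mx.
have x_neq0 : x != 0.
  apply: contraTneq isT => x0; move: Mx; rewrite x0 mulmx0 => /matrixP/(_ 0 0).
  by rewrite !mxE => /eqP; rewrite eq_sym oner_eq0.
have m0 := mass_neq0 _ _ x_neq0 Mx.
have mE : (const_mx 1 *m x : 'M_1) 0 0 = cof M / \det M.
  rewrite /x mulmxA /invmx uM -scalemxAr -scalemxAl mxE cof_adj.
  by rewrite [_%:M _ _]mxE mulr1n mulrC.
exists (((const_mx 1 *m x : 'M_1) 0 0)^-1 *: x).
  by rewrite -scalemxAr; apply/matrixP => i j; rewrite !ord1 [LHS]mxE mulVf // mxE.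
by rewrite -scalemxAr Mx mE invf_div; apply/matrixP=> i j; rewrite !mxE mulr1.
Qed.

Lemma delta_diff_form (R : realFieldType) (n : nat) (g : 'M[R]_n) (i j : 'I_n) :
    g^T = g ->
  ((delta_mx i 0 - delta_mx j 0 : 'cV[R]_n)^T *m g
   *m (delta_mx i 0 - delta_mx j 0 : 'cV[R]_n)) 0 0
  = g i i + g j j - 2 * g i j.
Proof.
move=> gT.
have d k l :
    (delta_mx k 0 : 'cV[R]_n)^T *m g *m (delta_mx l 0 : 'cV[R]_n) = (g k l)%:M.
  rewrite trmx_delta -rowE -colE; apply/matrixP => a b.
  by rewrite !ord1 !mxE eqxx mulr1n.
rewrite mulmxBr [_^T]linearB /= !mulmxBl !d !mxE eqxx !mulr1n.
by rewrite -[in g j i]gT mxE; ring.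
Qed.

(** * The energy of a potential *)

Section Graph.

Variables (R : realFieldType) (V E : finType) (G : wgraph R V E).

Let N := incidence G.
Let L := laplacian G.
Let g := MPinverse L.

Lemma tr_incidenceE (v : 'cV[R]_#|V|) (k : 'I_#|E|) :
  (N^T *m v) k 0 = v (enum_rank (Defs.head G (enum_val k))) 0
                   - v (enum_rank (Defs.tail G (enum_val k))) 0.
Proof.
have pick (x : V) :
    \sum_i (enum_val i == x)%:R * v i 0 = v (enum_rank x) 0.
  rewrite (bigD1 (enum_rank x)) //= enum_rankK eqxx mul1r big1 ?addr0 // => i.
  by rewrite -(inj_eq enum_val_inj) enum_rankK => /negPf ->; rewrite mul0r.
rewrite -!pick -sumrB mxE; apply: eq_bigr => i _.
by rewrite !mxE mulrBl.
Qed.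

Lemma mass_laplacian : const_mx 1 *m L = 0 :> 'M_(1, _).
Proof.
suff N1 : const_mx 1 *m N = 0 :> 'rV_#|E|.
  by rewrite /L /laplacian !mulmxA N1 !mul0mx.
apply: trmx_inj; rewrite trmx_mul trmx0 trmx_const.
by apply/matrixP => k j; rewrite !ord1 tr_incidenceE !mxE subrr.
Qed.

Lemma trmx_laplacian : L^T = L.
Proof. by rewrite /L /laplacian !trmx_mul trmxK tr_diag_mx mulmxA. Qed.

Lemma energyE (v : 'cV[R]_#|V|) :
  (v^T *m L *m v) 0 0
  = \sum_k conductance G (enum_val k) * (N^T *m v) k 0 ^+ 2.
Proof.
have -> : v^T *m L *m v = (N^T *m v)^T *m conductance_mx G *m (N^T *m v).
  by rewrite /L /laplacian trmx_mul trmxK !mulmxA.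
rewrite mxE; apply: eq_bigr => k _.
rewrite /conductance_mx mul_mx_diag [X in X * _]mxE [X in _ * X * _]mxE.
by rewrite [X in X * _ * _]mxE; ring.
Qed.

Lemma energy_ge0 (v : 'cV[R]_#|V|) : 0 <= (v^T *m L *m v) 0 0.
Proof.
rewrite energyE; apply: sumr_ge0 => k _.
by rewrite mulr_ge0 ?sqr_ge0 // ltW // conductance_gt0.
Qed.

Lemma energy_eq0 (v : 'cV[R]_#|V|) : (v^T *m L *m v) 0 0 = 0 -> N^T *m v = 0.
Proof.
rewrite energyE => /eqP; rewrite psumr_eq0 => [/allP e0|k _]; last first.
  by rewrite mulr_ge0 ?sqr_ge0 // ltW // conductance_gt0.
apply/matrixP => k j; rewrite ord1 [RHS]mxE; apply/eqP.
have := e0 k (mem_index_enum _).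
by rewrite /= mulf_eq0 (gt_eqF (conductance_gt0 _ _)) sqrf_eq0.
Qed.

Hypothesis connG : connected G.

(** A potential with no drop along any edge is constant along every path. *)
Lemma ker_incidence_const (v : 'cV[R]_#|V|) :
  N^T *m v = 0 -> forall i j, v i 0 = v j 0.
Proof.
move=> Nv i j; rewrite -[i]enum_valK -[j]enum_valK.
have /connectP[p] := connG (enum_val i) (enum_val j).
elim: p (enum_val i) => [|z p IHp] x /=; first by move=> _ ->.
case/andP=> xz /IHp{}IHp /IHp <-.
have {xz} [e xz] := existsP xz.
have := tr_incidenceE v (enum_rank e).
rewrite Nv mxE enum_rankK => /esym/subr0_eq.
by case/orP: xz => /andP[/eqP <- /eqP <-] ->.
Qed.

(** * The pseudoinverse on vectors of zero sum *)

Lemma trmx_MPlaplacian : g^T = g.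
Proof.
have [h1 h2 h3 h4] : is_MPinverse L g := MPinverseP L.
apply: (@is_MPinverse_uniq _ _ _ L) (MPinverseP L).
rewrite -trmx_laplacian; split.
- by rewrite -!trmx_mul mulmxA h1.
- by rewrite -!trmx_mul mulmxA h2.
- by rewrite -!trmx_mul h4.
- by rewrite -!trmx_mul h3.
Qed.

Lemma MPlaplacianC (i j : 'I_#|V|) : g i j = g j i.
Proof. by rewrite -[in LHS]trmx_MPlaplacian [LHS]mxE. Qed.

(** [L g] is the orthogonal projection on the range of [L], so the defect
    [u = x - L g x] lies in the kernel of [L]: it is constant by connectedness,
    and its sum is that of [x]. *)
Lemma laplacian_MPK (x : 'cV[R]_#|V|) :
  const_mx 1 *m x = 0 :> 'M_1 -> L *m (g *m x) = x.
Proof.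
move=> x1; have [h1 _ h3 _] : is_MPinverse L g := MPinverseP L.
pose u := x - L *m (g *m x).
have Lu : L *m u = 0.
  have LLg : L *m (L *m g) = L.
    by rewrite -h3 -{1}trmx_laplacian -trmx_mul h1 trmx_laplacian.
  by rewrite /u mulmxBr (mulmxA L g) (mulmxA L (L *m g)) LLg subrr.
have uN : N^T *m u = 0 by apply: energy_eq0; rewrite -mulmxA Lu mulmx0 mxE.
have u1 : const_mx 1 *m u = 0 :> 'M_1.
  by rewrite /u mulmxBr x1 (mulmxA _ L) mass_laplacian mul0mx subrr.
suff u0 : u = 0 by apply/esym/subr0_eq.
apply/matrixP => i j; rewrite ord1 [RHS]mxE; apply/eqP.
have := mass_sum u; rewrite u1 [LHS]mxE (eq_bigr (fun _ => u i 0)) => [|k _].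
  rewrite sumr_const card_ord => /esym/eqP; rewrite mulrn_eq0 => /orP[V0|//].
  by have := leq_ltn_trans (leq0n i) (ltn_ord i); rewrite lt0n V0.
exact: ker_incidence_const.
Qed.

(** With [y = g x] the form [x^T g x = y^T L y] is an energy, and vanishing
    energy forces [L y], which is [x], to vanish. *)
Lemma MPlaplacian_posdef (x : 'cV[R]_#|V|) :
  const_mx 1 *m x = 0 :> 'M_1 -> x != 0 -> 0 < (x^T *m g *m x) 0 0.
Proof.
move=> x1 x_neq0.
have e : x^T *m g *m x = (g *m x)^T *m L *m (g *m x).
  by rewrite -[RHS]mulmxA laplacian_MPK // trmx_mul trmx_MPlaplacian.
rewrite e lt_neqAle energy_ge0 andbT eq_sym.
apply: contraNneq x_neq0 => /energy_eq0 Ny; apply/eqP.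
by rewrite -[x]laplacian_MPK // /L /laplacian -mulmxA Ny mulmx0.
Qed.

(** * The resistance matrix *)

Lemma eff_res_MP (i j : V) :
  eff_res G i j = g (enum_rank i) (enum_rank i) + g (enum_rank j) (enum_rank j)
                  - 2 * g (enum_rank i) (enum_rank j).
Proof. exact: delta_diff_form trmx_MPlaplacian. Qed.

Let d : 'cV[R]_#|V| := \col_i g i i.

(** The first two terms contribute nothing to [x^T R x] when [x] has zero sum. *)
Lemma res_mxE :
  res_mx G = d *m const_mx 1 + const_mx 1 *m d^T - 2 *: g.
Proof.
apply/matrixP => i j; rewrite mxE eff_res_MP !enum_valK /d.
by move: g => h; rewrite !mxE !big_ord1 !mxE mulr1 mul1r.
Qed.

Lemma trmx_res_mx : (res_mx G)^T = res_mx G.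
Proof.
apply/matrixP => i j; rewrite !mxE !eff_res_MP.
by rewrite !enum_valK (MPlaplacianC j i) [X in X - _]addrC.
Qed.

Lemma res_mx_cnd : cond_neg_def (res_mx G).
Proof.
move=> x x1 x_neq0; have /= g_gt0 := MPlaplacian_posdef x1 x_neq0.
have xt1 : x^T *m const_mx 1 = 0 :> 'M_1.
  by apply: trmx_inj; rewrite trmx_mul trmxK trmx_const x1 trmx0.
rewrite res_mxE mulmxBr mulmxDr !mulmxBl !mulmxDl -!mulmxA x1 !mulmx0 add0r.
rewrite (mulmxA x^T (const_mx 1)) xt1 mul0mx add0r -scalemxAl -scalemxAr mulmxA.
move: g g_gt0 => h h_gt0.
by rewrite mxE [X in - X]mxE oppr_lt0 mulr_gt0.
Qed.

(** * The equilibrium charge of a set of vertices *)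

Let pos (S : {set V}) (k : 'I_#|S|) : 'I_#|V| := enum_rank (enum_val k).

Let sel (S : {set V}) : 'M[R]_(#|S|, #|V|) := rowsub (@pos S) 1%:M.

Lemma sel_mulmx (S : {set V}) (m : nat) (M : 'M[R]_(#|V|, m)) :
  sel S *m M = rowsub (@pos S) M.
Proof. by rewrite mul_rowsub_mx mul1mx. Qed.

Lemma principal_submxE (S : {set V}) (M : 'M[R]_#|V|) :
  principal_submx M S = sel S *m M *m (sel S)^T.
Proof.
rewrite sel_mulmx -[_ *m _]trmxK trmx_mul trmxK sel_mulmx.
by apply/matrixP => i j; rewrite !mxE.
Qed.

Lemma mass_sel (S : {set V}) (x : 'cV[R]_#|S|) :
  const_mx 1 *m ((sel S)^T *m x) = const_mx 1 *m x :> 'M_1.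
Proof.
rewrite mulmxA; congr (_ *m _); apply: trmx_inj.
rewrite trmx_mul trmxK !trmx_const sel_mulmx.
by apply/matrixP => i j; rewrite !mxE.
Qed.

Lemma sel_trK (S : {set V}) : sel S *m (sel S)^T = 1%:M.
Proof.
rewrite sel_mulmx; apply/matrixP => i j; rewrite !mxE.
by rewrite (inj_eq enum_rank_inj) (inj_eq enum_val_inj) eq_sym.
Qed.

Lemma principal_cnd (S : {set V}) : cond_neg_def (principal_submx (res_mx G) S).
Proof.
move=> x x1 x_neq0; rewrite principal_submxE.
have -> : x^T *m (sel S *m res_mx G *m (sel S)^T) *m x
          = ((sel S)^T *m x)^T *m res_mx G *m ((sel S)^T *m x).
  by rewrite trmx_mul trmxK !mulmxA.
apply: res_mx_cnd; first by rewrite mass_sel.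
apply: contraNneq x_neq0 => x0.
by rewrite -[x]mul1mx -sel_trK -mulmxA x0 mulmx0.
Qed.

(** The equilibrium charge of [S] is kept as a vector on all vertices, so that
    charges of different sets can be compared. *)
Lemma rho_equilibrium (S : {set V}) : S != set0 ->
  exists q : 'cV[R]_#|V|,
    [/\ forall i, enum_val i \notin S -> q i 0 = 0,
        const_mx 1 *m q = 1%:M :> 'M_1
      & forall i, enum_val i \in S -> (res_mx G *m q) i 0 = rho G S].
Proof.
rewrite -card_gt0 => S_gt0.
have [x x1 Mx] : exists2 x : 'cV[R]_#|S|, const_mx 1 *m x = 1%:M :> 'M_1
    & principal_submx (res_mx G) S *m x = const_mx (rho G S).
  rewrite /rho; have := @principal_cnd S.
  move: S_gt0 (principal_submx _ S); case: #|S| => // n _ M.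
  exact: equilibrium_charge.
exists ((sel S)^T *m x); split.
- move=> i iS; rewrite mxE big1 // => k _; rewrite !mxE.
  suff /negPf -> : pos k != i by rewrite mul0r.
  by apply: contraNneq iS => <-; rewrite enum_rankK enum_valP.
- by rewrite mass_sel.
move=> i iS; move: Mx; rewrite principal_submxE -!mulmxA sel_mulmx.
move=> /matrixP/(_ (enum_rank_in iS (enum_val i)) 0).
by rewrite mxE /pos enum_rankK_in // enum_valK [RHS]mxE.
Qed.

(** The potential [f] is the constant [a] wherever the charge [p] lives, so
    pairing them multiplies [a] by the mass of [p]. *)
Lemma charge_potential (S : {set V}) (p f : 'cV[R]_#|V|) (a : R) :
    (forall i, enum_val i \notin S -> p i 0 = 0) ->
    const_mx 1 *m p = 1%:M :> 'M_1 ->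
    (forall i, enum_val i \in S -> f i 0 = a) ->
  (p^T *m f) 0 0 = a.
Proof.
move=> pS p1 fS; transitivity ((const_mx 1 *m p : 'M_1) 0 0 * a); last first.
  by rewrite p1 mxE mul1r.
rewrite mass_sum mulr_suml mxE; apply: eq_bigr => i _; rewrite mxE.
by have [/fS ->|/pS ->] := boolP (enum_val i \in S); rewrite ?mul0r.
Qed.

End Graph.

Theorem corollary4p2 (R : realFieldType) (V E : finType) (G : wgraph R V E)
    (connG : connected G) (A B : {set V}) (A_neq0 : A != set0)
    (sAB : A \subset B) :
  rho G A <= rho G B.
Proof.
have [p [pA p1 Rp]] := rho_equilibrium connG A_neq0.
have B_neq0 : B != set0.
  by apply: contraNneq A_neq0 => B0; rewrite -subset0 -B0.
have [q [qB q1 Rq]] := rho_equilibrium connG B_neq0.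
have Epp := charge_potential pA p1 Rp.
have Eqq := charge_potential qB q1 Rq.
have Epq : (p^T *m (res_mx G *m q)) 0 0 = rho G B.
  by apply: charge_potential pA p1 _ => i iA; apply: Rq; apply: (subsetP sAB).
have Eqp : (q^T *m (res_mx G *m p)) 0 0 = rho G B.
  have -> : q^T *m (res_mx G *m p) = (p^T *m (res_mx G *m q))^T.
    by rewrite !trmx_mul trmxK trmx_res_mx // mulmxA.
  by rewrite [LHS]mxE.
have z1 : const_mx 1 *m (p - q) = 0 :> 'M_1 by rewrite mulmxBr p1 q1 subrr.
have := cond_neg_def_le0 (res_mx_cnd connG) z1.
have -> : ((p - q)^T *m res_mx G *m (p - q)) 0 0 = rho G A - rho G B.
  rewrite -mulmxA [_^T]linearB /= mulmxBr mulmxBl !mulmxBr.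
  have subE (X Y : 'M[R]_1) : (X - Y) 0 0 = X 0 0 - Y 0 0 by rewrite !mxE.
  by rewrite !subE Epp Epq Eqp Eqq subrr subr0.
by rewrite subr_le0.
Qed.
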